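(* Let $\alpha\ge 1$ and $\beta\ge \frac{1+\sqrt5}{2}$ be real numbers, and let $m\ge 0$ be an integer. Then for every $z\in\mathcal{U}$, $$\Re\left\{\frac{\mathbb{E}_{\alpha,\beta}(z)}{(\mathbb{E}_{\alpha,\beta})_m(z)}\right\}\ge\frac{\beta^2-\beta-1}{\beta^2}$$ and $$\Re\left\{\frac{(\mathbb{E}_{\alpha,\beta})_m(z)}{\mathbb{E}_{\alpha,\beta}(z)}\right\}\ge\frac{\beta^2}{\beta^2+\beta+1}.$$
   Context: $\mathcal{U}=\{z\in\mathbb{C}:|z|<1\}$ is the open unit disk and $\Gamma$ is the Gamma function. For $\alpha>0$, $\beta>0$ the normalized Mittag-Leffler function is $$\mathbb{E}_{\alpha,\beta}(z)=z+\sum_{n=1}^\infty A_n z^{n+1},\qquad A_n=\frac{\Gamma(\beta)}{\Gamma(\alpha n+\beta)},\quad z\in\mathcal{U}.$$ Its partial sums are $(\mathbb{E}_{\alpha,\beta})_0(z)=z$ and $(\mathbb{E}_{\alpha,\beta})_m(z)=z+\sum_{n=1}^m A_n z^{n+1}$ for integers $m\ge 1$. At $z=0$, where numerator and denominator both vanish to first order, the ratios are understood by analytic continuation (value $1$). *)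

(* Defs.v *)
From Stdlib Require Import Reals.
From Coquelicot Require Import Coquelicot.
Open Scope R_scope.

(* Euler's integral; it converges for x > 0. *)
Definition Gamma (x : R) : R :=
  RInt_gen (fun t => Rpower t (x - 1) * exp (- t))
    (at_right 0) (Rbar_locally p_infty).

Definition ML_coef (alpha beta : R) (n : nat) : R :=
  Gamma beta / Gamma (alpha * INR n + beta).

Definition ML_term (alpha beta : R) (z : C) (n : nat) : C :=
  (RtoC (ML_coef alpha beta n) * z ^ (n + 1))%C.

(* [Series] is real-valued only, so the sum of a complex series is obtained by
   applying the choice operator [iota] to [is_series]. *)
Definition C_Series (a : nat -> C) : C :=
  iota (T := C_CompleteNormedModule)
    (@is_series C_AbsRing C_NormedModule a).

(* The series starts at n = 1, hence the shift. *)
Definition ML (alpha beta : R) (z : C) : C :=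
  (z + C_Series (fun k => ML_term alpha beta z (S k)))%C.

(* For m = 0 the range 1..m is empty and the value is z. *)
Definition ML_partial (alpha beta : R) (m : nat) (z : C) : C :=
  (z + sum_n_m (G := C_AbelianMonoid) (ML_term alpha beta z) 1 m)%C.

(* f z / g z for f and g that vanish at 0 with the same nonzero derivative
   there: the singularity at 0 is removable, with value 1. *)
Definition ratio_ext (f g : C -> C) (z : C) : C :=
  if Ceq_dec z 0 then RtoC 1 else (f z / g z)%C.

(* Main.v *)
Require Import Defs.
From Stdlib Require Import Reals Lra Lia.
From Coquelicot Require Import Coquelicot.
Open Scope R_scope.

(** Write [a n] for the coefficients, [P = 1 + sum_(1 <= n <= m) a n * z ^ n]
    and [Q = 1 + sum_(n >= 1) a n * z ^ n], so that away from 0 the two ratios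
    are [Q / P] and [P / Q].

    The coefficients are dominated by a geometric sequence: Gamma is
    nondecreasing on [[2, infinity)] ([Gamma_le]), and both [n + beta] and
    [alpha * n + beta] lie there when [n >= 1], so the functional equation
    ([Gamma_succ]) gives [a n <= / (beta * (beta + 1) ^ (n - 1))].  Hence all
    the sums of coefficients are at most [s = (beta + 1) / beta ^ 2], and the
    condition on [beta] says exactly that [s <= 1].

    Let [s1] be the sum of the first [m] coefficients.  Then
    [|Q - P| <= s - s1 <= s * (1 - s1) <= s * |P|], where the middle inequality
    uses [s <= 1].  So [Q / P] lies in the closed disk of centre 1 and radius
    [s], on which the real part is at least
    [1 - s = (beta ^ 2 - beta - 1) / beta ^ 2]; the inverse [P / Q] has real
    part at least [/ (1 + s) = beta ^ 2 / (beta ^ 2 + beta + 1)]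
    ([Re_quotient_bounds]).  Neither [P] nor [Q] vanishes: each differs from 1
    by at most [s * |z| < 1].

    The facts on Gamma come from Euler's integral, whose convergence for
    [x >= 1] follows from the bound of its integrand by a multiple of
    [exp (- t / 2)] ([is_RInt_gen_Gamma]). *)

(** * Improper integrals over the positive half-line *)

Lemma near_0_infty (c d : R) (hc : 0 < c) :
  filter_prod (at_right 0) (Rbar_locally p_infty)
    (fun ab : R * R => (0 < fst ab < c) /\ d < snd ab).
Proof.
  apply Filter_prod with (Q := fun a => 0 < a < c) (R := fun b => d < b).
  - exists (mkposreal c hc); simpl; intros y hy hy0.
    split; [exact hy0|].
    unfold ball in hy; simpl in hy; unfold AbsRing_ball, abs, minus, plus, opp in hy;
      simpl in hy.
    apply Rabs_def2 in hy; lra.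
  - exists d; auto.
  - simpl; auto.
Qed.

Lemma ex_RInt_pos (f : R -> R) (a b : R)
    (cont : forall t, 0 < t -> continuous f t) (ha : 0 < a) (hb : 0 < b) :
  ex_RInt f a b.
Proof.
  apply (ex_RInt_continuous (V := R_CompleteNormedModule)).
  intros t [ht _]; apply cont.
  apply Rlt_le_trans with (2 := ht), Rmin_glb_lt; assumption.
Qed.

(** The limit is the supremum of the integrals over compact subintervals:
    these increase with the interval, because the integrand is nonnegative. *)
Lemma ex_RInt_gen_bounded (f : R -> R) (M : R)
    (cont : forall t, 0 < t -> continuous f t)
    (pos : forall t, 0 < t -> 0 <= f t)
    (bnd : forall a b, 0 < a <= b -> RInt f a b <= M) :
  exists l, is_RInt_gen f (at_right 0) (Rbar_locally p_infty) l /\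
    forall a b, 0 < a <= b -> RInt f a b <= l.
Proof.
  destruct (completeness
    (fun v => exists a b, 0 < a <= b /\ v = RInt f a b)) as [l [ub lub]].
  - exists M; intros v (a & b & hab & ->); auto.
  - exists (RInt f 1 1), 1, 1; split; [lra|reflexivity].
  - assert (ub' : forall a b, 0 < a <= b -> RInt f a b <= l).
    { intros a b hab; apply ub; exists a, b; auto. }
    exists l; split; [|exact ub'].
    apply (filterlimi_locally (U := R_UniformSpace)); intros eps.
    assert (approx : exists a b, 0 < a <= b /\ l - eps < RInt f a b).
    { apply Classical_Prop.NNPP; intro no.
      assert (h : l <= l - eps).
      { apply lub; intros v (a & b & hab & ->).
        apply Rnot_lt_le; intro hlt; apply no; exists a, b; auto. }
      pose proof (cond_pos eps); lra. }
    destruct approx as (a & b & hab & happ).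
    generalize (near_0_infty a b (proj1 hab)); apply filter_imp.
    intros [c d]; simpl; intros [hc hd].
    exists (RInt f c d); split.
    + apply (RInt_correct (V := R_CompleteNormedModule)), ex_RInt_pos; auto; lra.
    + assert (hcd : RInt f c d <= l) by (apply ub'; lra).
      assert (hle : RInt f a b <= RInt f c d).
      { rewrite <- (RInt_Chasles f c a d), <- (RInt_Chasles f a b d);
          try (apply ex_RInt_pos; auto; lra).
        unfold plus; simpl.
        assert (0 <= RInt f c a).
        { apply RInt_ge_0; [lra| apply ex_RInt_pos; auto; lra |].
          intros t ht; apply pos; lra. }
        assert (0 <= RInt f b d).
        { apply RInt_ge_0; [lra| apply ex_RInt_pos; auto; lra |].
          intros t ht; apply pos; lra. }
        lra. }
      unfold ball; simpl; unfold AbsRing_ball, abs, minus, plus, opp; simpl.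
      apply Rabs_def1; pose proof (cond_pos eps); lra.
Qed.

(** Only the limits of [F] at the two ends enter, so [F] may be badly behaved
    at 0 itself, as [Rpower] is. *)
Lemma is_RInt_gen_antiderivative (F f : R -> R) (l0 l1 : R)
    (der : forall t, 0 < t -> is_derive F t (f t))
    (cont : forall t, 0 < t -> continuous f t)
    (lim0 : filterlim F (at_right 0) (locally l0))
    (lim1 : filterlim F (Rbar_locally p_infty) (locally l1)) :
  is_RInt_gen f (at_right 0) (Rbar_locally p_infty) (l1 - l0).
Proof.
  apply filterlimi_lim_ext_loc with (f := fun ab : R * R => F (snd ab) - F (fst ab)).
  - generalize (near_0_infty 1 0 Rlt_0_1); apply filter_imp.
    intros [a b]; simpl; intros [ha hb].
    assert (hmin : 0 < Rmin a b) by (apply Rmin_glb_lt; lra).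
    apply (is_RInt_derive (V := R_CompleteNormedModule) F f);
      intros t ht; [apply der|apply cont]; lra.
  - apply (filterlim_comp_2 (fun ab : R * R => F (snd ab))
      (fun ab : R * R => - F (fst ab)) (fun u v : R => u + v)
      (G := locally l1) (H := locally (- l0))).
    + apply filterlim_comp with (2 := lim1), filterlim_snd.
    + apply filterlim_comp with (g := fun u : R => - u) (G := locally l0).
      * apply filterlim_comp with (2 := lim0), filterlim_fst.
      * apply (filterlim_opp (V := R_NormedModule) l0).
    + apply (filterlim_plus (V := R_NormedModule) l1 (- l0)).
Qed.

Lemma is_RInt_gen_ge_0 (f : R -> R) (l : R)
    (pos : forall t, 0 < t -> 0 <= f t)
    (hl : is_RInt_gen f (at_right 0) (Rbar_locally p_infty) l) : 0 <= l.
Proof.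
  apply Rle_trans with (norm l); [apply norm_ge_0|].
  apply (RInt_gen_norm (V := R_CompleteNormedModule)
           (Fa := at_right 0) (Fb := Rbar_locally p_infty) f f l l); auto.
  - generalize (near_0_infty 1 1 Rlt_0_1); apply filter_imp.
    intros [a b]; simpl; lra.
  - generalize (near_0_infty 1 1 Rlt_0_1); apply filter_imp.
    intros [a b]; simpl; intros [ha hb] t ht.
    unfold norm; simpl; unfold abs; simpl.
    rewrite Rabs_pos_eq; [lra|apply pos; lra].
Qed.

(** * The Gamma function on the half-line from 1 *)

Definition gamma_integrand (x t : R) : R := Rpower t (x - 1) * exp (- t).

Lemma is_derive_Rpower (p t : R) (ht : 0 < t) :
  is_derive (fun u => Rpower u p) t (p * Rpower t (p - 1)).
Proof. apply is_derive_Reals, derivable_pt_lim_power, ht. Qed.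

Lemma continuous_gamma_integrand (x t : R) (ht : 0 < t) :
  continuous (gamma_integrand x) t.
Proof.
  apply (ex_derive_continuous (V := R_NormedModule)).
  eexists; apply (is_derive_mult (fun u => Rpower u (x - 1)) (fun u => exp (- u))).
  - apply is_derive_Rpower, ht.
  - auto_derive; [trivial|reflexivity].
  - intros; apply Rmult_comm.
Qed.

Lemma gamma_integrand_pos (x t : R) : 0 < gamma_integrand x t.
Proof. apply Rmult_lt_0_compat; apply exp_pos. Qed.

Lemma exp_le_compat (u v : R) (h : u <= v) : exp u <= exp v.
Proof.
  destruct h as [h|h]; [left; apply exp_increasing, h|right; f_equal; exact h].
Qed.

Lemma ln_le_sub_1 (t : R) (ht : 0 < t) : ln t <= t - 1.
Proof.
  pose proof (exp_ineq1_le (ln t)) as h; rewrite exp_ln in h by exact ht; lra.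
Qed.

(** From [ln u <= u] at [u = t / c]; the scale [c = 2 (p + 1)] makes the
    slope of the resulting linear bound of [p * ln t] at most one half. *)
Lemma Rpower_mul_exp_le (p : R) (hp : 0 <= p) :
  exists K, 0 < K /\
    forall t, 0 < t -> Rpower t p * exp (- t) <= K * exp (- t / 2).
Proof.
  set (c := 2 * (p + 1)).
  exists (exp (p * ln c)); split; [apply exp_pos|].
  intros t ht; unfold Rpower; rewrite <- !exp_plus.
  assert (hc : 0 < c) by (unfold c; lra).
  assert (h : p * ln t <= t / 2 + p * ln c).
  { replace t with (t / c * c) at 1 by (field; lra).
    assert (htc : 0 < t / c) by (apply Rdiv_lt_0_compat; lra).
    rewrite ln_mult by assumption.
    pose proof (ln_le_sub_1 (t / c) htc).
    assert (p * ln (t / c) <= p * (t / c)) by (apply Rmult_le_compat_l; lra).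
    assert (p * (t / c) <= t / 2).
    { replace (t / 2) with ((p + 1) * (t / c)) by (unfold c; field; lra).
      apply Rmult_le_compat_r; lra. }
    lra. }
  apply exp_le_compat; lra.
Qed.

Lemma filterlim_Rpower_mul_exp_0 (p : R) (hp : 1 <= p) :
  filterlim (fun t => Rpower t p * exp (- t)) (at_right 0) (locally 0).
Proof.
  apply filterlim_locally; intros eps.
  assert (hmin : 0 < Rmin 1 eps) by (apply Rmin_glb_lt; [lra|apply cond_pos]).
  exists (mkposreal _ hmin); simpl; intros t ht ht0.
  unfold ball in *; simpl in *; unfold AbsRing_ball, abs, minus, plus, opp in *;
    simpl in *.
  rewrite Ropp_0, Rplus_0_r in *.
  rewrite Rabs_pos_eq in ht by lra.
  assert (h1 : t < 1) by (eapply Rlt_le_trans; [exact ht|apply Rmin_l]).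
  assert (h2 : t < eps) by (eapply Rlt_le_trans; [exact ht|apply Rmin_r]).
  rewrite Rabs_pos_eq by (apply Rmult_le_pos; left; apply exp_pos).
  apply Rle_lt_trans with (2 := h2).
  assert (hpow : Rpower t p <= t).
  { rewrite <- (exp_ln t) at 2 by exact ht0.
    pose proof (ln_le_sub_1 t ht0); apply exp_le_compat; nra. }
  assert (hexp : exp (- t) <= 1).
  { rewrite <- exp_0; apply exp_le_compat; lra. }
  apply Rle_trans with (t * 1); [|lra].
  apply Rmult_le_compat; auto; left; apply exp_pos.
Qed.

Lemma filterlim_Rpower_mul_exp_infty (p : R) (hp : 0 <= p) :
  filterlim (fun t => Rpower t p * exp (- t)) (Rbar_locally p_infty) (locally 0).
Proof.
  destruct (Rpower_mul_exp_le p hp) as (K & hK & hle).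
  apply filterlim_locally; intros eps.
  pose proof (cond_pos eps) as heps.
  assert (hq : 0 < eps / K) by (apply Rdiv_lt_0_compat; assumption).
  exists (Rmax 0 (-2 * ln (eps / K))); intros t ht.
  assert (h0 : 0 < t) by (eapply Rle_lt_trans; [apply Rmax_l|exact ht]).
  assert (h1 : -2 * ln (eps / K) < t) by (eapply Rle_lt_trans; [apply Rmax_r|exact ht]).
  unfold ball; simpl; unfold AbsRing_ball, abs, minus, plus, opp; simpl.
  rewrite Ropp_0, Rplus_0_r.
  rewrite Rabs_pos_eq by (apply Rmult_le_pos; left; apply exp_pos).
  apply Rle_lt_trans with (1 := hle t h0).
  assert (h : exp (- t / 2) < eps / K).
  { rewrite <- (exp_ln (eps / K)) by exact hq; apply exp_increasing; lra. }
  apply Rmult_lt_compat_l with (r := K) in h; [|exact hK].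
  replace (K * (eps / K)) with (pos eps) in h by (field; lra).
  exact h.
Qed.

Lemma is_RInt_gen_Gamma (x : R) (hx : 1 <= x) :
  is_RInt_gen (gamma_integrand x) (at_right 0) (Rbar_locally p_infty) (Gamma x) /\
  forall a b, 0 < a <= b -> RInt (gamma_integrand x) a b <= Gamma x.
Proof.
  destruct (Rpower_mul_exp_le (x - 1)) as (K & hK & hle); [lra|].
  destruct (ex_RInt_gen_bounded (gamma_integrand x) (2 * K)) as (l & hl & hsup).
  - apply continuous_gamma_integrand.
  - intros t _; left; apply gamma_integrand_pos.
  - intros a b hab.
    assert (hint : is_RInt (fun t => K * exp (- t / 2)) a b
                     (- 2 * K * exp (- b / 2) - - 2 * K * exp (- a / 2))).
    { apply (is_RInt_derive (V := R_CompleteNormedModule)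
        (fun t => - 2 * K * exp (- t / 2)) (fun t => K * exp (- t / 2))).
      - intros t _; auto_derive; [trivial|]; unfold Rdiv; field.
      - intros t _; apply (ex_derive_continuous (V := R_NormedModule)).
        auto_derive; trivial. }
    apply Rle_trans with (RInt (fun t => K * exp (- t / 2)) a b).
    + apply RInt_le; [lra| | |].
      * apply ex_RInt_pos; try lra; apply continuous_gamma_integrand.
      * eexists; exact hint.
      * intros t ht; apply hle; lra.
    + rewrite (is_RInt_unique _ _ _ _ hint).
      assert (exp (- a / 2) <= 1).
      { rewrite <- exp_0; apply exp_le_compat; lra. }
      pose proof (exp_pos (- b / 2)); nra.
  - assert (heq : Gamma x = l)
      by exact (is_RInt_gen_unique (V := R_CompleteNormedModule)
                  (gamma_integrand x) l hl).
    rewrite heq; auto.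
Qed.

Lemma Gamma_pos (x : R) (hx : 1 <= x) : 0 < Gamma x.
Proof.
  apply Rlt_le_trans with (RInt (gamma_integrand x) 1 2).
  - apply RInt_gt_0; [lra| |].
    + intros t _; apply gamma_integrand_pos.
    + intros t ht; apply continuous_gamma_integrand; lra.
  - apply is_RInt_gen_Gamma; lra.
Qed.

(** Integration by parts: [x * gamma_integrand x - gamma_integrand (x + 1)] is
    the derivative of [Rpower t x * exp (- t)], which tends to 0 at both ends. *)
Lemma Gamma_succ (x : R) (hx : 1 <= x) : Gamma (x + 1) = x * Gamma x.
Proof.
  assert (hparts : is_RInt_gen
    (fun t => minus (scal x (gamma_integrand x t)) (gamma_integrand (x + 1) t))
    (at_right 0) (Rbar_locally p_infty) (0 - 0)).
  { apply (is_RInt_gen_antiderivative (fun t => Rpower t x * exp (- t))).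
    - intros t ht.
      replace (minus _ _) with
        (plus (mult (x * Rpower t (x - 1)) (exp (- t)))
              (mult (Rpower t x) (- exp (- t)))).
      + apply (is_derive_mult (fun u => Rpower u x) (fun u => exp (- u))).
        * apply is_derive_Rpower, ht.
        * auto_derive; [trivial|ring].
        * intros; apply Rmult_comm.
      + unfold gamma_integrand, minus, plus, opp, scal, mult; simpl;
          unfold mult; simpl.
        replace (x + 1 - 1) with x by ring; ring.
    - intros t ht.
      apply (continuous_minus (V := R_NormedModule)
        (fun t => scal x (gamma_integrand x t)) (gamma_integrand (x + 1))).
      + apply (continuous_scal_r (V := R_NormedModule)), continuous_gamma_integrand, ht.
      + apply continuous_gamma_integrand, ht.
    - apply filterlim_Rpower_mul_exp_0, hx.
    - apply filterlim_Rpower_mul_exp_infty; lra. }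
  assert (hdiff : is_RInt_gen
    (fun t => minus (scal x (gamma_integrand x t)) (gamma_integrand (x + 1) t))
    (at_right 0) (Rbar_locally p_infty) (minus (scal x (Gamma x)) (Gamma (x + 1)))).
  { apply (is_RInt_gen_minus (V := R_NormedModule)).
    - apply (is_RInt_gen_scal (V := R_NormedModule)), is_RInt_gen_Gamma, hx.
    - apply is_RInt_gen_Gamma; lra. }
  apply (is_RInt_gen_unique (V := R_CompleteNormedModule)) in hparts, hdiff.
  rewrite hparts in hdiff.
  unfold minus, plus, opp, scal, mult in hdiff; simpl in hdiff.
  unfold mult in hdiff; simpl in hdiff; lra.
Qed.

Lemma one_add_mul_ln_le_Rpower (d t : R) : 1 + d * ln t <= Rpower t d.
Proof. apply exp_ineq1_le. Qed.

(** At [t = 1] both sides vanish.  Write [Rpower t (x - 1)] as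
    [t * Rpower t (x - 2)]: as [Rpower t (x - 2) - 1] and [Rpower t d - 1] never
    have opposite signs, replacing the factor [Rpower t (x - 2)] by 1 only
    decreases the right side; what remains, [t * (Rpower t d - 1)], is convex in [t] with tangent
    [d * (t - 1)] at 1. *)
Lemma tangent_le_Rpower_sub (x d t : R) (hx : 2 <= x) (hd : 0 <= d) (ht : 0 < t) :
  d * (t - 1) <= Rpower t (x + d - 1) - Rpower t (x - 1).
Proof.
  replace (x + d - 1) with (1 + (x - 2) + d) by ring.
  replace (x - 1) with (1 + (x - 2)) by ring.
  rewrite !Rpower_plus, Rpower_1 by exact ht.
  set (u := Rpower t (x - 2)); set (v := Rpower t d).
  assert (hu : 1 + (x - 2) * ln t <= u) by apply one_add_mul_ln_le_Rpower.
  assert (hv : 1 + d * ln t <= v) by apply one_add_mul_ln_le_Rpower.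
  assert (hln : 1 - / t <= ln t).
  { pose proof (ln_le_sub_1 (/ t) (Rinv_0_lt_compat t ht)) as h.
    rewrite ln_Rinv in h by exact ht; lra. }
  assert (htan : d * (t - 1) <= t * (v - 1)).
  { replace (d * (t - 1)) with (t * (d * (1 - / t))) by (field; lra).
    apply Rmult_le_compat_l; [lra|]; nra. }
  assert (hsign : 0 <= (u - 1) * (v - 1)).
  { destruct (Rle_or_lt 0 (ln t)) as [h|h].
    - apply Rmult_le_pos; nra.
    - assert (u <= 1 /\ v <= 1) as [hu1 hv1]; [|nra].
      unfold u, v, Rpower; rewrite <- exp_0.
      split; apply exp_le_compat; nra. }
  nra.
Qed.

(** The tangent bound integrates to zero, since
    [(t - 1) * exp (- t)] is the derivative of [- t * exp (- t)]. *)
Lemma Gamma_le (x y : R) (hx : 2 <= x) (hxy : x <= y) : Gamma x <= Gamma y.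
Proof.
  set (d := y - x).
  assert (htan : is_RInt_gen (fun t => d * (t - 1) * exp (- t))
    (at_right 0) (Rbar_locally p_infty) (- d * 0 - - d * 0)).
  { apply (is_RInt_gen_antiderivative (fun t => - d * (t * exp (- t)))).
    - intros t _; auto_derive; [trivial|ring].
    - intros t _; apply (ex_derive_continuous (V := R_NormedModule)).
      auto_derive; trivial.
    - apply filterlim_comp with (f := fun t => t * exp (- t))
        (g := fun u => - d * u) (G := locally 0);
        [|apply (filterlim_scal_r (V := R_NormedModule) (- d) 0)].
      apply filterlim_ext_loc with (f := fun t => Rpower t 1 * exp (- t));
        [|apply filterlim_Rpower_mul_exp_0; lra].
      exists (mkposreal 1 Rlt_0_1); intros t _ ht; rewrite Rpower_1; auto.
    - apply filterlim_comp with (f := fun t => t * exp (- t))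
        (g := fun u => - d * u) (G := locally 0);
        [|apply (filterlim_scal_r (V := R_NormedModule) (- d) 0)].
      apply filterlim_ext_loc with (f := fun t => Rpower t 1 * exp (- t));
        [|apply filterlim_Rpower_mul_exp_infty; lra].
      exists 0; intros t ht; rewrite Rpower_1; auto. }
  assert (hdiff : is_RInt_gen
    (fun t => minus (minus (gamma_integrand y t) (gamma_integrand x t))
                (d * (t - 1) * exp (- t)))
    (at_right 0) (Rbar_locally p_infty)
    (minus (minus (Gamma y) (Gamma x)) (- d * 0 - - d * 0))).
  { apply (is_RInt_gen_minus (V := R_NormedModule)); [|exact htan].
    apply (is_RInt_gen_minus (V := R_NormedModule)); apply is_RInt_gen_Gamma; lra. }
  apply is_RInt_gen_ge_0 in hdiff.
  - unfold minus, plus, opp in hdiff; simpl in hdiff; lra.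
  - intros t ht.
    pose proof (tangent_le_Rpower_sub x d t hx ltac:(unfold d; lra) ht) as h.
    replace (x + d - 1) with (y - 1) in h by (unfold d; ring).
    unfold gamma_integrand, minus, plus, opp; simpl.
    pose proof (exp_pos (- t)); nra.
Qed.

(** * Coefficients of the Mittag-Leffler function *)

Lemma Gamma_add_ge (b : R) (n : nat) (hb : 1 <= b) :
  b * (b + 1) ^ n * Gamma b <= Gamma (INR (S n) + b).
Proof.
  induction n as [|n IH].
  - replace (INR 1 + b) with (b + 1) by (simpl; ring).
    rewrite Gamma_succ by exact hb; simpl; lra.
  - replace (INR (S (S n)) + b) with (INR (S n) + b + 1)
      by (rewrite (S_INR (S n)); ring).
    rewrite S_INR in *; pose proof (pos_INR n) as hn.
    rewrite Gamma_succ by lra.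
    apply Rle_trans with ((b + 1) * (b * (b + 1) ^ n * Gamma b)).
    + right; simpl; ring.
    + apply Rmult_le_compat; try lra.
      repeat apply Rmult_le_pos; try lra; [apply pow_le; lra|].
      left; apply Gamma_pos, hb.
Qed.

Lemma ML_coef_bounds (alpha beta : R) (n : nat) (ha : 1 <= alpha) (hb : 1 <= beta) :
  0 <= ML_coef alpha beta (S n) <= / beta * (/ (beta + 1)) ^ n.
Proof.
  pose proof (Gamma_pos beta hb) as hG.
  pose proof (Gamma_add_ge beta n hb) as hle.
  assert (hmono : Gamma (INR (S n) + beta) <= Gamma (alpha * INR (S n) + beta)).
  { rewrite S_INR; pose proof (pos_INR n); apply Gamma_le; nra. }
  assert (hpow : 0 < (beta + 1) ^ n) by (apply pow_lt; lra).
  assert (hprod : 0 < beta * (beta + 1) ^ n) by (apply Rmult_lt_0_compat; lra).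
  assert (hden : 0 < beta * (beta + 1) ^ n * Gamma beta)
    by (apply Rmult_lt_0_compat; lra).
  unfold ML_coef; split.
  - left; apply Rdiv_lt_0_compat; lra.
  - replace (/ beta * (/ (beta + 1)) ^ n)
      with (Gamma beta / (beta * (beta + 1) ^ n * Gamma beta)).
    + apply Rmult_le_compat_l; [lra|]; apply Rinv_le_contravar; lra.
    + rewrite pow_inv; field; lra.
Qed.

(** The bound is the full sum of the geometric majorant,
    [/ beta / (1 - / (beta + 1))]. *)
Lemma sum_n_m_ML_coef_le (alpha beta : R) (N : nat)
    (ha : 1 <= alpha) (hb : 1 <= beta) :
  sum_n_m (ML_coef alpha beta) 1 N <= (beta + 1) / beta ^ 2.
Proof.
  (* The factor in parentheses makes the bound provable by induction. *)
  assert (h : sum_n_m (ML_coef alpha beta) 1 N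
    <= (beta + 1) / beta ^ 2 * (1 - (/ (beta + 1)) ^ N)).
  { induction N as [|N IH].
    - rewrite sum_n_m_zero by lia; unfold zero; simpl; lra.
    - rewrite sum_n_Sm by lia; unfold plus; simpl plus.
      pose proof (ML_coef_bounds alpha beta N ha hb) as [_ hc].
      eapply Rle_trans; [apply Rplus_le_compat; [exact IH|exact hc]|].
      right; simpl; field; lra. }
  apply Rle_trans with (1 := h).
  assert (0 <= (/ (beta + 1)) ^ N).
  { apply pow_le; left; apply Rinv_0_lt_compat; lra. }
  assert (0 <= (beta + 1) / beta ^ 2).
  { left; apply Rdiv_lt_0_compat; [lra|apply pow_lt; lra]. }
  nra.
Qed.

(** * Power series with small nonnegative coefficients *)

Definition pow_term (a : nat -> R) (z : C) (n : nat) : C := (RtoC (a n) * z ^ n)%C.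

Definition pow_partial (a : nat -> R) (z : C) (m : nat) : C :=
  sum_n_m (G := C_AbelianMonoid) (pow_term a z) 1 m.

Lemma Cmod_filterlim_le (u : nat -> C) (l w : C) (M : R)
    (hu : filterlim u eventually (locally (T := C_UniformSpace) l))
    (hM : eventually (fun n => Cmod (u n - w) <= M)) :
  Cmod (l - w) <= M.
Proof.
  apply (filterlim_le (F := eventually) (fun n => Cmod (u n - w)%C) (fun _ => M)
    (Finite (Cmod (l - w)%C)) (Finite M) hM); [|apply filterlim_const].
  apply filterlim_comp with (f := fun n => (u n - w)%C) (g := Cmod)
    (G := locally (T := C_UniformSpace) (l - w)%C).
  - apply (filterlim_comp_2 (F := eventually) u (fun _ => (- w)%C) Cplus
      (G := locally (T := C_UniformSpace) l)
      (H := locally (T := C_UniformSpace) (- w)%C)).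
    + exact hu.
    + apply filterlim_const.
    + apply (filterlim_plus (V := C_NormedModule) l (- w)%C).
  - apply (filterlim_norm (V := C_NormedModule) (l - w)%C).
Qed.

(** Used with [r = 1] for the size of blocks of terms, and with [r = Cmod z]
    for the strict bounds that keep the denominators away from 0. *)
Lemma Cmod_sum_pow_le (a : nat -> R) (z : C) (r : R) (p n : nat)
    (hp : (1 <= p)%nat) (pos : forall n, 0 <= a (S n))
    (hr : forall n, Cmod z ^ S n <= r) :
  Cmod (sum_n_m (G := C_AbelianMonoid) (pow_term a z) p n) <= r * sum_n_m a p n.
Proof.
  eapply Rle_trans; [apply (norm_sum_n_m (V := C_NormedModule))|].
  rewrite <- (sum_n_m_mult_l (K := R_Ring) r a).
  destruct p as [|p]; [lia|].
  destruct n as [|n].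
  - rewrite !sum_n_m_zero by lia; apply Rle_refl.
  - rewrite <- !sum_n_m_S; apply sum_n_m_le; intros k.
    change (Cmod (pow_term a z (S k)) <= r * a (S k)).
    unfold pow_term; rewrite Cmod_mult, Cmod_R, Cmod_pow.
    rewrite Rabs_pos_eq by apply pos.
    rewrite Rmult_comm; apply Rmult_le_compat_r; auto.
Qed.

Section SmallCoefficients.

Variables (a : nat -> R) (s : R) (z : C).
Hypothesis pos : forall n, 0 <= a (S n).
Hypothesis bnd : forall N, sum_n_m a 1 N <= s.
Hypothesis hz : Cmod z < 1.

Let pow_le_1 (n : nat) : Cmod z ^ S n <= 1.
Proof.
  rewrite <- (pow1 (S n)); apply pow_incr; split; [apply Cmod_ge_0|lra].
Qed.

Let pow_le_Cmod (n : nat) : Cmod z ^ S n <= Cmod z.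
Proof.
  pose proof (Cmod_ge_0 z); simpl.
  assert (Cmod z ^ n <= 1); [|nra].
  rewrite <- (pow1 n); apply pow_incr; lra.
Qed.

Lemma ex_series_pow_term :
  ex_series (V := C_NormedModule) (fun k => pow_term a z (S k)).
Proof.
  apply (ex_series_le (V := C_CompleteNormedModule)) with (b := fun k => a (S k)).
  - intros n; change (Cmod (pow_term a z (S n)) <= a (S n)).
    unfold pow_term; rewrite Cmod_mult, Cmod_R, Cmod_pow, Rabs_pos_eq by apply pos.
    pose proof (pow_le_1 n); pose proof (pos n); nra.
  - destruct (ex_finite_lim_seq_incr (sum_n (fun k => a (S k))) s) as [l hl].
    + intros n; rewrite sum_Sn; unfold plus; simpl; pose proof (pos (S n)); lra.
    + intros n; unfold sum_n; rewrite sum_n_m_S; apply bnd.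
    + exists l; exact hl.
Qed.

Variable T : C.
Hypothesis hT : is_series (V := C_NormedModule) (fun k => pow_term a z (S k)) T.

Let partial_lim :
  filterlim (fun N => pow_partial a z (S N)) eventually
    (locally (T := C_UniformSpace) T).
Proof.
  apply filterlim_ext with (2 := hT); intros N.
  unfold sum_n, pow_partial; rewrite <- sum_n_m_S; reflexivity.
Qed.

Lemma Cmod_pow_partial_le (m : nat) : Cmod (pow_partial a z m) <= sum_n_m a 1 m.
Proof.
  rewrite <- (Rmult_1_l (sum_n_m a 1 m)).
  apply Cmod_sum_pow_le; auto.
Qed.

Lemma Cmod_pow_partial_lt_1 (m : nat) (hs : s <= 1) : Cmod (pow_partial a z m) < 1.
Proof.
  apply Rle_lt_trans with (2 := hz).
  apply Rle_trans with (Cmod z * sum_n_m a 1 m).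
  - apply Cmod_sum_pow_le; auto.
  - pose proof (bnd m); pose proof (Cmod_ge_0 z); nra.
Qed.

Lemma Cmod_sum_lt_1 (hs : s <= 1) : Cmod T < 1.
Proof.
  apply Rle_lt_trans with (2 := hz).
  replace T with (T - 0)%C by ring.
  apply Cmod_filterlim_le with (1 := partial_lim).
  exists O; intros N _.
  replace (pow_partial a z (S N) - 0)%C with (pow_partial a z (S N)) by ring.
  apply Rle_trans with (Cmod z * sum_n_m a 1 (S N)).
  - apply Cmod_sum_pow_le; auto.
  - pose proof (bnd (S N)); pose proof (Cmod_ge_0 z); nra.
Qed.

(** The partial sums of the tail are bounded by sums of [a] over indices beyond
    [m], for which only [s] minus the sum up to [m] is left. *)
Lemma Cmod_tail_le (m : nat) : Cmod (T - pow_partial a z m) <= s - sum_n_m a 1 m.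
Proof.
  apply Cmod_filterlim_le with (1 := partial_lim).
  exists m; intros N hN.
  assert (hC : pow_partial a z (S N) = (pow_partial a z m
    + sum_n_m (G := C_AbelianMonoid) (pow_term a z) (S m) (S N))%C).
  { apply (sum_n_m_Chasles (G := C_AbelianMonoid)); lia. }
  rewrite hC.
  assert (hcancel : forall v w : C, (v + w - v)%C = w) by (intros; ring).
  rewrite hcancel.
  pose proof (bnd (S N)) as hb.
  rewrite (sum_n_m_Chasles a 1 m (S N)) in hb by lia.
  unfold plus in hb; simpl plus in hb.
  eapply Rle_trans; [apply Cmod_sum_pow_le with (r := 1); auto; lia|].
  simpl in hb; lra.
Qed.

End SmallCoefficients.

(** * Real parts of quotients near 1 *)

Lemma one_add_neq_0 (w : C) (hw : Cmod w < 1) : (1 + w)%C <> 0.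
Proof.
  intro h.
  assert (hw1 : w = (- (1))%C) by (replace w with ((1 + w) - 1)%C by ring; rewrite h; ring).
  rewrite hw1, Cmod_m1 in hw; lra.
Qed.

(** Inversion maps the closed disk of centre 1 and radius [s] into the
    half-plane right of [/ (1 + s)], the image of the boundary point [1 + s]. *)
Lemma Re_inv_one_add_ge (u : C) (s : R) (hu : Cmod u <= s) (hs : s <= 1)
    (h0 : (1 + u)%C <> 0) : / (1 + s) <= Re (/ (1 + u)).
Proof.
  pose proof (Cmod_ge_0 u) as hpos.
  assert (hsq : Re u ^ 2 + Im u ^ 2 <= s ^ 2).
  { rewrite <- Cmod2_alt; apply pow_incr; lra. }
  assert (hre : Re u <= s).
  { apply Rle_trans with (2 := hu), Rle_trans with (2 := re_le_Cmod u), Rle_abs. }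
  assert (hden : 0 < Re (1 + u) ^ 2 + Im (1 + u) ^ 2).
  { rewrite <- Cmod2_alt; apply pow_lt, Cmod_gt_0, h0. }
  assert (hinv : Re (/ (1 + u)) = (1 + Re u) / (Re (1 + u) ^ 2 + Im (1 + u) ^ 2)).
  { reflexivity. }
  rewrite hinv.
  assert (hRe : Re (1 + u) = 1 + Re u) by reflexivity.
  assert (hIm : Im (1 + u) = Im u) by apply Rplus_0_l.
  rewrite hRe, hIm in *.
  apply Rmult_le_reg_r with ((1 + s) * ((1 + Re u) ^ 2 + Im u ^ 2));
    [apply Rmult_lt_0_compat; lra|].
  replace (/ (1 + s) * ((1 + s) * ((1 + Re u) ^ 2 + Im u ^ 2)))
    with ((1 + Re u) ^ 2 + Im u ^ 2) by (field; lra).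
  replace ((1 + Re u) / ((1 + Re u) ^ 2 + Im u ^ 2)
    * ((1 + s) * ((1 + Re u) ^ 2 + Im u ^ 2))) with ((1 + Re u) * (1 + s))
    by (field; lra).
  (* The difference of the two sides is at least [(1 - s) * (s - Re u)]. *)
  assert (0 <= (1 - s) * (s - Re u)) by (apply Rmult_le_pos; lra).
  nra.
Qed.

Lemma Re_quotient_bounds (P Q : C) (s : R) (hs : s <= 1)
    (hP : P <> 0) (hQ : Q <> 0) (hPQ : Cmod (Q - P) <= s * Cmod P) :
  1 - s <= Re (Q / P) /\ / (1 + s) <= Re (P / Q).
Proof.
  set (u := ((Q - P) / P)%C).
  assert (hu : Cmod u <= s).
  { unfold u; rewrite Cmod_div by exact hP.
    apply Cmod_gt_0 in hP.
    apply Rmult_le_reg_r with (Cmod P); [exact hP|].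
    unfold Rdiv; rewrite Rmult_assoc, Rinv_l by lra; lra. }
  assert (h1 : (Q / P)%C = (1 + u)%C) by (unfold u; field; exact hP).
  assert (h0 : (1 + u)%C <> 0).
  { rewrite <- h1; intro h; apply hQ.
    replace Q with (Q / P * P)%C by (field; exact hP); rewrite h; ring. }
  assert (h2 : (P / Q)%C = (/ (1 + u))%C).
  { rewrite <- h1; field; split; assumption. }
  split.
  - rewrite h1; pose proof (re_le_Cmod u) as h.
    apply Rabs_le_between in h.
    change (1 - s <= 1 + Re u); lra.
  - rewrite h2; apply Re_inv_one_add_ge; assumption.
Qed.

(** * The ratios *)

Lemma C_Series_unique (a : nat -> C) (l : C)
    (hl : is_series (V := C_NormedModule) a l) : C_Series a = l.
Proof. apply (iota_filterlim_locally (V := C_CompleteNormedModule) (F := eventually)), hl. Qed.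

Lemma ML_term_eq (alpha beta : R) (z : C) (n : nat) :
  ML_term alpha beta z n = (z * pow_term (ML_coef alpha beta) z n)%C.
Proof. unfold ML_term, pow_term; rewrite Nat.add_1_r; simpl; ring. Qed.

Lemma ML_eq (alpha beta : R) (z T : C)
    (hT : is_series (V := C_NormedModule)
      (fun k => pow_term (ML_coef alpha beta) z (S k)) T) :
  ML alpha beta z = (z * (1 + T))%C.
Proof.
  unfold ML; rewrite (C_Series_unique _ (z * T)); [ring|].
  apply (is_series_ext (V := C_NormedModule)
    (fun k => scal z (pow_term (ML_coef alpha beta) z (S k)))).
  - intros k; symmetry; apply ML_term_eq.
  - apply (is_series_scal (V := C_NormedModule)), hT.
Qed.

Lemma ML_partial_eq (alpha beta : R) (m : nat) (z : C) :
  ML_partial alpha beta m z = (z * (1 + pow_partial (ML_coef alpha beta) z m))%C.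
Proof.
  unfold ML_partial, pow_partial.
  rewrite (sum_n_m_ext (G := C_AbelianMonoid) _ _ 1 m (ML_term_eq alpha beta z)).
  rewrite (sum_n_m_mult_l (K := C_Ring) z).
  change (z + z * sum_n_m (G := C_AbelianMonoid) (pow_term (ML_coef alpha beta) z) 1 m
    = z * (1 + sum_n_m (G := C_AbelianMonoid) (pow_term (ML_coef alpha beta) z) 1 m))%C.
  ring.
Qed.

Lemma golden_ratio_bounds (beta : R) (h : beta >= (1 + sqrt 5) / 2) :
  1 <= beta /\ beta + 1 <= beta ^ 2.
Proof.
  assert (h5 : sqrt 5 * sqrt 5 = 5) by (apply sqrt_sqrt; lra).
  pose proof (sqrt_pos 5); nra.
Qed.

Theorem theorem2p1 (alpha beta : R) (m : nat)
    (halpha : alpha >= 1) (hbeta : beta >= (1 + sqrt 5) / 2)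
    (z : C) (hz : Cmod z < 1) :
  Re (ratio_ext (ML alpha beta) (ML_partial alpha beta m) z)
    >= (beta ^ 2 - beta - 1) / beta ^ 2 /\
  Re (ratio_ext (ML_partial alpha beta m) (ML alpha beta) z)
    >= beta ^ 2 / (beta ^ 2 + beta + 1).
Proof.
  destruct (golden_ratio_bounds beta hbeta) as [hb hgold].
  apply Rge_le in halpha.
  set (s := (beta + 1) / beta ^ 2).
  assert (hb2 : 0 < beta ^ 2) by lra.
  assert (hs0 : 0 < s) by (apply Rdiv_lt_0_compat; lra).
  assert (hs1 : s <= 1).
  { apply Rmult_le_reg_r with (beta ^ 2); [lra|].
    unfold s, Rdiv; rewrite Rmult_assoc, Rinv_l; lra. }
  replace ((beta ^ 2 - beta - 1) / beta ^ 2) with (1 - s) by (unfold s; field; lra).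
  replace (beta ^ 2 / (beta ^ 2 + beta + 1)) with (/ (1 + s))
    by (unfold s; field; lra).
  unfold ratio_ext; destruct (Ceq_dec z 0) as [_|z0].
  { change (Re 1) with 1; split; apply Rle_ge; [lra|].
    rewrite <- Rinv_1; apply Rinv_le_contravar; lra. }
  set (a := ML_coef alpha beta).
  assert (pos : forall n, 0 <= a (S n)).
  { intros n; apply ML_coef_bounds; assumption. }
  assert (bnd : forall N, sum_n_m a 1 N <= s).
  { intros N; apply sum_n_m_ML_coef_le; assumption. }
  destruct (ex_series_pow_term a s z pos bnd hz) as [T hT].
  rewrite (ML_eq alpha beta z T hT), ML_partial_eq; fold a.
  set (P := (1 + pow_partial a z m)%C); set (Q := (1 + T)%C).
  assert (hP : P <> 0).
  { apply one_add_neq_0, (Cmod_pow_partial_lt_1 a s z); assumption. }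
  assert (hQ : Q <> 0).
  { apply one_add_neq_0, (Cmod_sum_lt_1 a s z); assumption. }
  assert (hQP : Cmod (Q - P) <= s * Cmod P).
  { pose proof (Cmod_tail_le a s z pos bnd hz T hT m) as htail.
    replace (Q - P)%C with (T - pow_partial a z m)%C by (unfold P, Q; ring).
    assert (hPge : 1 - sum_n_m a 1 m <= Cmod P).
    { pose proof (Cmod_pow_partial_le a z pos hz m) as hle.
      pose proof (Cmod_triangle P (- pow_partial a z m)) as htri.
      replace (P + - pow_partial a z m)%C with (RtoC 1) in htri by (unfold P; ring).
      rewrite Cmod_opp, Cmod_1 in htri; lra. }
    assert (hsum : 0 <= sum_n_m a 1 m).
    { eapply Rle_trans; [apply Cmod_ge_0|apply (Cmod_pow_partial_le a z pos hz m)]. }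
    (* By [s <= 1], [s - s1 <= s - s * s1] for the sum [s1] of the first [m]
       coefficients. *)
    nra. }
  replace (z * Q / (z * P))%C with (Q / P)%C by (field; split; assumption).
  replace (z * P / (z * Q))%C with (P / Q)%C by (field; split; assumption).
  destruct (Re_quotient_bounds P Q s hs1 hP hQ hQP).
  split; apply Rle_ge; assumption.
Qed.
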